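(* Let $q_{\mathrm B}=e^{\pi\mathrm i/6}$, $r=q_{\mathrm B}^3=\mathrm i$, $G=q_{\mathrm B}^2R_3$ and $E=I-\frac{G-G^{-1}}{q_{\mathrm B}-q_{\mathrm B}^{-1}}$ on $V\otimes V$, $V=\mathbb C^3$. For every $n\ge2$, the assignments $$g_i\mapsto G_i,\qquad e_i\mapsto E_i\qquad(1\le i<n)$$ extend to a representation $C_n(r,q_{\mathrm B})\to\mathrm{End}(V^{\otimes n})$ of the BMW algebra. In particular $E_i^2=3E_i$. Moreover, the pullbacks of $3^{-n}\mathrm{Tr}$ along these representations form the normalized BMW Markov trace.
   Context: Let $\omega=e^{2\pi\mathrm i/3}$ and let $V=\mathbb C^3$ have orthonormal basis $e_x$, $x\in\mathbb F_3$. $R_3$ is the unitary Yang--Baxter operator on $V\otimes V$ $$R_3(e_x\otimes e_y)=3^{-1/2}\sum_{t\in\mathbb F_3}\omega^{t^2+t-(x+y)^2+(x+y)}\,e_{x+t}\otimes e_{y-t}.$$ $G_i,E_i$ are the local copies $I^{\otimes(i-1)}\otimes G\otimes I^{\otimes(n-i-1)}$, $I^{\otimes(i-1)}\otimes E\otimes I^{\otimes(n-i-1)}$ on $V^{\otimes n}$. $C_n(r,q)$ is the Birman--Murakami--Wenzl algebra: the unital complex algebra generated by invertible $g_1,\dots,g_{n-1}$ and $e_1,\dots,e_{n-1}$ with the braid relations for the $g_i$, $g_i-g_i^{-1}=(q-q^{-1})(1-e_i)$, $e_ig_i=r^{-1}e_i$, and $e_ig_{i\pm1}^{\epsilon}e_i=r^{\epsilon}e_i$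 for $\epsilon\in\{1,-1\}$; in it $e_i^2=xe_i$ with $x=\frac{r-r^{-1}}{q-q^{-1}}+1$, which equals $3$ for the present parameters. The normalized BMW Markov trace (loop parameter $x=3$) is the family of linear forms $\mathrm{tr}_n$ on $C_n(r,q_{\mathrm B})$ with $\mathrm{tr}_n(1)=1$, $\mathrm{tr}_n(ab)=\mathrm{tr}_n(ba)$, and, for all $a\in C_n(r,q_{\mathrm B})$, $\mathrm{tr}_{n+1}(ag_n^{\pm1})=\frac{r^{\pm1}}3\mathrm{tr}_n(a)$ and $\mathrm{tr}_{n+1}(ae_n)=\frac13\mathrm{tr}_n(a)$. *)

(* Defs.v *)
From HB Require Import structures.
From mathcomp Require Import all_boot all_order all_algebra.
From mathcomp Require Import boolp reals trigo.
From mathcomp Require Import complex mxtens ring.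

Set Implicit Arguments.
Unset Strict Implicit.
Unset Printing Implicit Defensive.

Import Order.TTheory GRing.Theory Num.Theory.
Local Open Scope ring_scope.
Local Open Scope quotient_scope.

(* Unital associative algebras presented by generators X and relations rel:
   formal expressions modulo the least congruence that contains rel and makes
   the quotient a unital associative K-algebra. *)

Inductive alg_term (K X : Type) : Type :=
| TGen of X
| TZero
| TOne
| TOpp of alg_term K X
| TAdd of alg_term K X & alg_term K X
| TMul of alg_term K X & alg_term K X
| TScale of K & alg_term K X.

Arguments TGen {K X}.
Arguments TZero {K X}.
Arguments TOne {K X}.

HB.instance Definition _ (K X : Type) := gen_eqMixin (alg_term K X).
HB.instance Definition _ (K X : Type) := gen_choiceMixin (alg_term K X).

Inductive alg_cong (K : pzRingType) (X : Type)
    (rel : alg_term K X -> alg_term K X -> Prop) :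
    alg_term K X -> alg_term K X -> Prop :=
| cong_rel u v : rel u v -> alg_cong rel u v
| cong_refl u : alg_cong rel u u
| cong_sym u v : alg_cong rel u v -> alg_cong rel v u
| cong_trans u v w : alg_cong rel u v -> alg_cong rel v w -> alg_cong rel u w
| cong_opp u u' : alg_cong rel u u' -> alg_cong rel (TOpp u) (TOpp u')
| cong_add u u' v v' : alg_cong rel u u' -> alg_cong rel v v' ->
    alg_cong rel (TAdd u v) (TAdd u' v')
| cong_mul u u' v v' : alg_cong rel u u' -> alg_cong rel v v' ->
    alg_cong rel (TMul u v) (TMul u' v')
| cong_scale a u u' : alg_cong rel u u' ->
    alg_cong rel (TScale a u) (TScale a u')
| cong_addA u v w :
    alg_cong rel (TAdd u (TAdd v w)) (TAdd (TAdd u v) w)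
| cong_addC u v : alg_cong rel (TAdd u v) (TAdd v u)
| cong_add0 u : alg_cong rel (TAdd TZero u) u
| cong_addN u : alg_cong rel (TAdd (TOpp u) u) TZero
| cong_mulA u v w :
    alg_cong rel (TMul u (TMul v w)) (TMul (TMul u v) w)
| cong_mul1l u : alg_cong rel (TMul TOne u) u
| cong_mul1r u : alg_cong rel (TMul u TOne) u
| cong_mulDl u v w :
    alg_cong rel (TMul (TAdd u v) w) (TAdd (TMul u w) (TMul v w))
| cong_mulDr u v w :
    alg_cong rel (TMul u (TAdd v w)) (TAdd (TMul u v) (TMul u w))
| cong_scaleA a b u :
    alg_cong rel (TScale a (TScale b u)) (TScale (a * b) u)
| cong_scale1 u : alg_cong rel (TScale 1 u) u
| cong_scaleDr a u v :
    alg_cong rel (TScale a (TAdd u v)) (TAdd (TScale a u) (TScale a v))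
| cong_scaleDl a b u :
    alg_cong rel (TScale (a + b) u) (TAdd (TScale a u) (TScale b u))
| cong_scaleAl a u v :
    alg_cong rel (TScale a (TMul u v)) (TMul (TScale a u) v)
| cong_scaleAr a u v :
    alg_cong rel (TScale a (TMul u v)) (TMul u (TScale a v)).

Section PresentedAlgebra.
Variables (K : pzRingType) (X : Type).
Variable rel : alg_term K X -> alg_term K X -> Prop.

Definition alg_congb (u v : alg_term K X) : bool := `[< alg_cong rel u v >].

Lemma alg_congb_refl : reflexive alg_congb.
Proof. by move=> u; apply/asboolP; apply: cong_refl. Qed.

Lemma alg_congb_sym : symmetric alg_congb.
Proof. by move=> u v; apply/asboolP/asboolP; apply: cong_sym. Qed.

Lemma alg_congb_trans : transitive alg_congb.
Proof.
by move=> v u w /asboolP uv /asboolP vw; apply/asboolP; apply: cong_trans uv vw.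
Qed.

Canonical alg_cong_equiv :=
  EquivRel alg_congb alg_congb_refl alg_congb_sym alg_congb_trans.

Definition pres_alg : Type := {eq_quot alg_congb}.
HB.instance Definition _ := EqQuotient.on pres_alg.
HB.instance Definition _ := Choice.on pres_alg.

Definition pres_pi (u : alg_term K X) : pres_alg := \pi_pres_alg u.

Lemma pres_piE u v : alg_cong rel u v <-> pres_pi u = pres_pi v.
Proof.
by split=> [uv|/eqmodP/asboolP //]; apply/eqmodP/asboolP.
Qed.

Lemma pres_repr u : alg_cong rel (repr (pres_pi u)) u.
Proof. by apply/pres_piE; rewrite /pres_pi reprK. Qed.

Lemma pres_piK (a : pres_alg) : pres_pi (repr a) = a.
Proof. exact: reprK. Qed.

Definition pres_opp (a : pres_alg) := pres_pi (TOpp (repr a)).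
Definition pres_add (a b : pres_alg) := pres_pi (TAdd (repr a) (repr b)).
Definition pres_mul (a b : pres_alg) := pres_pi (TMul (repr a) (repr b)).
Definition pres_scale (c : K) (a : pres_alg) := pres_pi (TScale c (repr a)).

Lemma pres_pi_opp u : pres_opp (pres_pi u) = pres_pi (TOpp u).
Proof. by apply/pres_piE/cong_opp/pres_repr. Qed.

Lemma pres_pi_add u v : pres_add (pres_pi u) (pres_pi v) = pres_pi (TAdd u v).
Proof. by apply/pres_piE/cong_add; apply: pres_repr. Qed.

Lemma pres_pi_mul u v : pres_mul (pres_pi u) (pres_pi v) = pres_pi (TMul u v).
Proof. by apply/pres_piE/cong_mul; apply: pres_repr. Qed.

Lemma pres_pi_scale c u : pres_scale c (pres_pi u) = pres_pi (TScale c u).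
Proof. by apply/pres_piE/cong_scale/pres_repr. Qed.

Let presE := (pres_pi_opp, pres_pi_add, pres_pi_mul, pres_pi_scale).

Let pres_ind (P : pres_alg -> Prop) :
  (forall u, P (pres_pi u)) -> forall a, P a.
Proof. by move=> Pu a; rewrite -(pres_piK a). Qed.

Fact pres_addA : associative pres_add.
Proof.
elim/pres_ind=> u; elim/pres_ind=> v; elim/pres_ind=> w.
by rewrite !presE; apply/pres_piE/cong_addA.
Qed.

Fact pres_addC : commutative pres_add.
Proof.
elim/pres_ind=> u; elim/pres_ind=> v.
by rewrite !presE; apply/pres_piE/cong_addC.
Qed.

Fact pres_add0 : left_id (pres_pi TZero) pres_add.
Proof. by elim/pres_ind=> u; rewrite !presE; apply/pres_piE/cong_add0. Qed.

Fact pres_addN : left_inverse (pres_pi TZero) pres_opp pres_add.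
Proof. by elim/pres_ind=> u; rewrite !presE; apply/pres_piE/cong_addN. Qed.

HB.instance Definition _ := GRing.isZmodule.Build pres_alg
  pres_addA pres_addC pres_add0 pres_addN.

Fact pres_mulA : associative pres_mul.
Proof.
elim/pres_ind=> u; elim/pres_ind=> v; elim/pres_ind=> w.
by rewrite !presE; apply/pres_piE/cong_mulA.
Qed.

Fact pres_mul1l : left_id (pres_pi TOne) pres_mul.
Proof. by elim/pres_ind=> u; rewrite !presE; apply/pres_piE/cong_mul1l. Qed.

Fact pres_mul1r : right_id (pres_pi TOne) pres_mul.
Proof. by elim/pres_ind=> u; rewrite !presE; apply/pres_piE/cong_mul1r. Qed.

Fact pres_mulDl : left_distributive pres_mul pres_add.
Proof.
elim/pres_ind=> u; elim/pres_ind=> v; elim/pres_ind=> w.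
by rewrite !presE; apply/pres_piE/cong_mulDl.
Qed.

Fact pres_mulDr : right_distributive pres_mul pres_add.
Proof.
elim/pres_ind=> u; elim/pres_ind=> v; elim/pres_ind=> w.
by rewrite !presE; apply/pres_piE/cong_mulDr.
Qed.

HB.instance Definition _ := GRing.Zmodule_isPzRing.Build pres_alg
  pres_mulA pres_mul1l pres_mul1r pres_mulDl pres_mulDr.

Fact pres_scaleA a b u : pres_scale a (pres_scale b u) = pres_scale (a * b) u.
Proof.
by elim/pres_ind: u => u; rewrite !presE; apply/pres_piE/cong_scaleA.
Qed.

Fact pres_scale1 : left_id 1 pres_scale.
Proof. by elim/pres_ind=> u; rewrite !presE; apply/pres_piE/cong_scale1. Qed.

Fact pres_scaleDr : right_distributive pres_scale +%R.
Proof.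
move=> a; elim/pres_ind=> u; elim/pres_ind=> v.
by rewrite /GRing.add /= !presE; apply/pres_piE/cong_scaleDr.
Qed.

Fact pres_scaleDl u : {morph pres_scale^~ u : a b / a + b}.
Proof.
elim/pres_ind: u => u a b.
by rewrite [RHS]/GRing.add /= !presE; apply/pres_piE/cong_scaleDl.
Qed.

HB.instance Definition _ := GRing.Zmodule_isLmodule.Build K pres_alg
  pres_scaleA pres_scale1 pres_scaleDr pres_scaleDl.

Lemma pres_scaleAl (c : K) (a b : pres_alg) : c *: (a * b) = (c *: a) * b.
Proof.
elim/pres_ind: a => u; elim/pres_ind: b => v.
rewrite /GRing.mul /GRing.scale /= !presE.
by apply/pres_piE/cong_scaleAl.
Qed.

Lemma pres_scaleAr (c : K) (a b : pres_alg) : c *: (a * b) = a * (c *: b).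
Proof.
elim/pres_ind: a => u; elim/pres_ind: b => v.
rewrite /GRing.mul /GRing.scale /= !presE.
by apply/pres_piE/cong_scaleAr.
Qed.

End PresentedAlgebra.

Fixpoint term_map (K X Y : Type) (f : X -> Y) (u : alg_term K X) :
    alg_term K Y :=
  match u with
  | TGen x => TGen (f x)
  | TZero => TZero
  | TOne => TOne
  | TOpp u => TOpp (term_map f u)
  | TAdd u v => TAdd (term_map f u) (term_map f v)
  | TMul u v => TMul (term_map f u) (term_map f v)
  | TScale a u => TScale a (term_map f u)
  end.

(* The Birman-Murakami-Wenzl algebra C_n(r,q).  Indices are 0-based: the
   generator with index i is the g_{i+1} (resp. e_{i+1}) of the usual
   numbering; BgV i is the inverse of Bg i. *)

Inductive bmw_gen (n : nat) : Type :=
| Bg of 'I_n.-1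
| BgV of 'I_n.-1
| Be of 'I_n.-1.

Section BMW.
Variables (K : fieldType) (r q : K).

Local Notation tg i := (TGen (Bg i)).
Local Notation tgV i := (TGen (BgV i)).
Local Notation te i := (TGen (Be i)).
Local Notation "u ** v" := (TMul u v) (at level 40, left associativity).

Definition adjacent (i j : nat) : bool := (j == i.+1) || (i == j.+1).

Inductive bmw_rel (n : nat) :
    alg_term K (bmw_gen n) -> alg_term K (bmw_gen n) -> Prop :=
| bmw_mulgV (i : 'I_n.-1) : bmw_rel (tg i ** tgV i) TOne
| bmw_mulVg (i : 'I_n.-1) : bmw_rel (tgV i ** tg i) TOne
| bmw_braid (i j : 'I_n.-1) : adjacent i j ->
    bmw_rel (tg i ** tg j ** tg i) (tg j ** tg i ** tg j)
| bmw_far (i j : 'I_n.-1) : (i.+1 < j)%N -> bmw_rel (tg i ** tg j) (tg j ** tg i)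
| bmw_skein (i : 'I_n.-1) :
    bmw_rel (TAdd (tg i) (TOpp (tgV i)))
            (TScale (q - q^-1) (TAdd TOne (TOpp (te i))))
| bmw_untwist (i : 'I_n.-1) : bmw_rel (te i ** tg i) (TScale r^-1 (te i))
| bmw_ege (i j : 'I_n.-1) : adjacent i j ->
    bmw_rel (te i ** tg j ** te i) (TScale r (te i))
| bmw_egVe (i j : 'I_n.-1) : adjacent i j ->
    bmw_rel (te i ** tgV j ** te i) (TScale r^-1 (te i)).

Definition bmw (n : nat) : Type := pres_alg (@bmw_rel n).
HB.instance Definition _ n := GRing.PzRing.on (bmw n).
HB.instance Definition _ n := GRing.Lmodule.on (bmw n).

Definition bmw_g n (i : 'I_n.-1) : bmw n := pres_pi (@bmw_rel n) (tg i).
Definition bmw_gV n (i : 'I_n.-1) : bmw n := pres_pi (@bmw_rel n) (tgV i).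
Definition bmw_e n (i : 'I_n.-1) : bmw n := pres_pi (@bmw_rel n) (te i).

Definition bmw_gen_widen n (x : bmw_gen n) : bmw_gen n.+1 :=
  match x with
  | Bg i => Bg (n := n.+1) (widen_ord (leq_pred n) i)
  | BgV i => BgV (n := n.+1) (widen_ord (leq_pred n) i)
  | Be i => Be (n := n.+1) (widen_ord (leq_pred n) i)
  end.

(* The canonical homomorphism C_n -> C_{n+1}, g_i |-> g_i, e_i |-> e_i. *)
Definition bmw_incl n (a : bmw n) : bmw n.+1 :=
  pres_pi (@bmw_rel n.+1) (term_map (@bmw_gen_widen n) (repr a)).

Lemma bmw_gen_widen_rel n u v : bmw_rel u v ->
  bmw_rel (term_map (@bmw_gen_widen n) u) (term_map (@bmw_gen_widen n) v).
Proof. by case=> *; constructor. Qed.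

Lemma bmw_gen_widen_cong n u v : alg_cong (@bmw_rel n) u v ->
  alg_cong (@bmw_rel n.+1)
    (term_map (@bmw_gen_widen n) u) (term_map (@bmw_gen_widen n) v).
Proof.
elim=> /= *; first by apply/cong_rel/bmw_gen_widen_rel.
all: try by constructor.
by apply: cong_trans; eassumption.
Qed.

Lemma bmw_incl_pi n u : bmw_incl (pres_pi (@bmw_rel n) u) =
  pres_pi (@bmw_rel n.+1) (term_map (@bmw_gen_widen n) u).
Proof. by apply/pres_piE/bmw_gen_widen_cong/pres_repr. Qed.

(* With n = m.+1 strands, ord_max is the index of g_n and e_n in C_{n+1}. *)
Definition bmw_markov_trace (x : K) (tr : forall n, bmw n -> K) : Prop :=
  [/\ forall n, scalar (tr n),
      forall n, tr n 1 = 1,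
      forall n (a b : bmw n), tr n (a * b) = tr n (b * a) &
      forall m (a : bmw m.+1),
        [/\ tr m.+2 (bmw_incl a * bmw_g (n := m.+2) ord_max)
              = r / x * tr m.+1 a,
            tr m.+2 (bmw_incl a * bmw_gV (n := m.+2) ord_max)
              = r^-1 / x * tr m.+1 a &
            tr m.+2 (bmw_incl a * bmw_e (n := m.+2) ord_max)
              = x^-1 * tr m.+1 a]].

End BMW.

(* V^{\otimes n} is C^(3^n) with Kronecker products *t, and an endomorphism is
   the matrix acting on column vectors. *)

Lemma local_copy_dim (d n : nat) (i : 'I_n.-1) :
  (d ^ i * (d * d) * d ^ (n - i - 2) = d ^ n)%N.
Proof.
rewrite mulnn -!expnD; congr (d ^ _)%N.
case: n i => [[]|[[]|n i]] //=; rewrite -subnDA subnKC // addn2.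
exact: (ltn_ord i).
Qed.

Definition local_copy (K : pzRingType) (d n : nat) (A : 'M[K]_(d * d))
    (i : 'I_n.-1) : 'M[K]_(d ^ n) :=
  castmx (local_copy_dim d i, local_copy_dim d i)
    ((1%:M : 'M[K]_(d ^ i)) *t A *t (1%:M : 'M[K]_(d ^ (n - i - 2)))).

Section YangBaxter.
Variable R : realType.
Local Open Scope complex_scope.

Definition expi (t : R) : R[i] := cos t +i* sin t.

Definition omega3 : R[i] := expi (2 * pi / 3).

Definition ebasis (x : 'F_3) : 'cV[R[i]]_3 := delta_mx x 0.

(* Computed in F_3, which is harmless since it is only used as an exponent of
   omega3 and omega3 ^+ 3 = 1. *)
Definition R3_exponent (x y t : 'F_3) : 'F_3 :=
  t ^+ 2 + t - (x + y) ^+ 2 + (x + y).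

Definition R3_image (x y : 'F_3) : 'cV[R[i]]_(3 * 3) :=
  ((Num.sqrt 3)%:C)^-1 *:
    \sum_(t : 'F_3)
      omega3 ^+ R3_exponent x y t *: (ebasis (x + t) *t ebasis (y - t)).

Definition R3 : 'M[R[i]]_(3 * 3) :=
  \matrix_(i, j) R3_image (mxtens_unindex j).1 (mxtens_unindex j).2 i 0.

Definition qB : R[i] := expi (pi / 6).
Definition rB : R[i] := qB ^+ 3.

Lemma rB_eq_i : rB = 'i.
Proof.
have h1 : pi / 6 + pi / 6 + pi / 6 = pi / 2 :> R by field.
have expiD s t : expi (s + t) = expi s * expi t.
  by rewrite /expi cosD sinD; apply/eqP; rewrite eq_complex /= eqxx addrC eqxx.
by rewrite /rB /qB !exprS expr0 mulr1 mulrA -!expiD h1 /expi cos_pihalf sin_pihalf.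
Qed.

Definition Gop : 'M[R[i]]_(3 * 3) := qB ^+ 2 *: R3.
Definition Eop : 'M[R[i]]_(3 * 3) :=
  1%:M - (qB - qB^-1)^-1 *: (Gop - invmx Gop).

End YangBaxter.

(* Main.v *)
From HB Require Import structures.
Require Import Defs.
From mathcomp Require Import all_boot all_order all_algebra.
From mathcomp Require Import reals trigo complex mxtens ring zify.

Set Implicit Arguments.
Unset Strict Implicit.
Unset Printing Implicit Defensive.

Import Order.TTheory GRing.Theory Num.Theory.
Local Open Scope ring_scope.

(** Let X be the cyclic shift and Z the clock matrix on C^3, w = omega3, and
    U = w (X (x) X^2), W = w (Z (x) Z).  U and W commute and have cube 1.  With
    A = 1 + U + U^2 and B = 1 + W + W^2 the Gauss sums in R_3 factor as
      G    =  (r/3) ((1 - w) + w A) ((1 - w) + w B),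
      G^-1 = (r^-1/3) ((1 - w^2) + w^2 A) ((1 - w^2) + w^2 B),   E = A B / 3.
    On neighbouring sites (U_i, W_j) and (W_i, U_j) are Weyl pairs (they commute
    up to w), while U_i, U_j commute and W_i, W_j commute.  Hence (A_i, B_j) and
    (B_i, A_j) are Temperley-Lieb pairs (A_i B_j A_i = 3 A_i, etc.), and every
    BMW relation follows from those of two commuting Temperley-Lieb families.
    For the Markov property, the partial trace over the last factor of
    X^a Z^b (x) X^2a Z^b vanishes unless a = b = 0 mod 3, so only the
    coefficient of 1 in G, G^-1 and E survives. *)

(** * Matrix representations of presented algebras *)

Section TermEvaluation.
Variables (K : comPzRingType) (X : Type) (N : nat) (f : X -> 'M[K]_N).

Fixpoint term_eval (u : alg_term K X) : 'M[K]_N :=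
  match u with
  | TGen x => f x
  | TZero => 0
  | TOne => 1%:M
  | TOpp u => - term_eval u
  | TAdd u v => term_eval u + term_eval v
  | TMul u v => term_eval u *m term_eval v
  | TScale a u => a *: term_eval u
  end.

Variable rel : alg_term K X -> alg_term K X -> Prop.
Hypothesis f_rel : forall u v, rel u v -> term_eval u = term_eval v.

Lemma term_eval_cong u v : alg_cong rel u v -> term_eval u = term_eval v.
Proof.
elim=> //= {u v}.
- by move=> u v w _ -> _ ->.
- by move=> u u' _ ->.
- by move=> u u' v v' _ -> _ ->.
- by move=> u u' v v' _ -> _ ->.
- by move=> a u u' _ ->.
- by move=> u v w; rewrite addrA.
- by move=> u v; rewrite addrC.
- by move=> u; rewrite add0r.
- by move=> u; rewrite addNr.
- by move=> u v w; rewrite mulmxA.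
- by move=> u; rewrite mul1mx.
- by move=> u; rewrite mulmx1.
- by move=> u v w; rewrite mulmxDl.
- by move=> u v w; rewrite mulmxDr.
- by move=> a b u; rewrite scalerA.
- by move=> u; rewrite scale1r.
- by move=> a u v; rewrite scalerDr.
- by move=> a b u; rewrite scalerDl.
- by move=> a u v; rewrite scalemxAl.
- by move=> a u v; rewrite scalemxAr.
Qed.

(** The representative is arbitrary; [term_eval_cong] makes the value independent of it. *)
Definition pres_lift (a : pres_alg rel) : 'M[K]_N := term_eval (repr a).

Lemma pres_lift_pi u : pres_lift (pres_pi rel u) = term_eval u.
Proof. exact/term_eval_cong/pres_repr. Qed.

Lemma pres_lift_zmod_morphism : zmod_morphism pres_lift.
Proof.
move=> a b; rewrite -(pres_piK a) -(pres_piK b).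
by rewrite /GRing.opp /GRing.add /= pres_pi_opp pres_pi_add !pres_lift_pi.
Qed.

Lemma pres_lift_monoid_morphism : monoid_morphism pres_lift.
Proof.
split=> [|a b]; first exact: pres_lift_pi.
rewrite -(pres_piK a) -(pres_piK b).
by rewrite {1}/GRing.mul /= pres_pi_mul !pres_lift_pi.
Qed.

Lemma pres_lift_scalable : scalable pres_lift.
Proof.
move=> c a; rewrite -(pres_piK a).
by rewrite {1}/GRing.scale /= pres_pi_scale !pres_lift_pi.
Qed.

HB.instance Definition _ := GRing.isZmodMorphism.Build (pres_alg rel) 'M[K]_N
  pres_lift pres_lift_zmod_morphism.
HB.instance Definition _ := GRing.isMonoidMorphism.Build (pres_alg rel) 'M[K]_N
  pres_lift pres_lift_monoid_morphism.

Definition pres_lift_rmorphism : {rmorphism pres_alg rel -> 'M[K]_N} :=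
  pres_lift.

End TermEvaluation.

(* Equality of tagged matrices is equality up to a cast of the dimension; with
   it the Kronecker product is a strictly associative operation. *)
Local Notation tmx A := (Tagged (fun n => 'M_n) A).

(** * Kronecker products up to casts of the dimension *)

Section KroneckerMonoid.
Variable K : comPzRingType.

Local Notation sqmx := {n : nat & 'M[K]_n}.

Definition kron (u v : sqmx) : sqmx := tmx (tagged u *t tagged v).
Definition kid (n : nat) : sqmx := tmx (1%:M : 'M[K]_n).

Lemma tmx_inj n (A B : 'M[K]_n) : tmx A = tmx B -> A = B.
Proof. by move/eqP; rewrite eq_Tagged => /eqP. Qed.

Lemma tmx_eqP n m (A : 'M[K]_n) (B : 'M[K]_m) (e : n = m) :
  castmx (e, e) A = B -> tmx A = tmx B.
Proof. by case: _ / e B => B <-; rewrite castmx_id. Qed.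

Lemma tmx_cast n m (A : 'M[K]_n) (e1 e2 : n = m) :
  tmx (castmx (e1, e2) A) = tmx A.
Proof. by case: _ / e1 e2 => e2; rewrite castmx_id. Qed.

Lemma kronA : associative kron.
Proof.
case=> m A [n B] [p C]; apply: (tmx_eqP (e := mulnA m n p)) => /=.
have idxA a b c : cast_ord (esym (mulnA m n p))
    (mxtens_index (mxtens_index (a, b), c)) =
  mxtens_index (a, mxtens_index (b, c)).
  by apply: val_inj; rewrite /= mulnDl addnA mulnA.
apply/matrixP=> i j; rewrite castmxE.
case: (mxtens_indexP i) => ab c; case: (mxtens_indexP ab) => a b.
case: (mxtens_indexP j) => ab' c'; case: (mxtens_indexP ab') => a' b'.
by rewrite !idxA !tensmxE mulrA.
Qed.

Lemma tensmx11 m n : (1%:M : 'M[K]_m) *t (1%:M : 'M[K]_n) = 1%:M.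
Proof.
apply/matrixP=> i j; rewrite !mxE -natrM mulnb -xpair_eqE.
by rewrite -!surjective_pairing (can_eq (@mxtens_unindexK m n)).
Qed.

Lemma kron_kid m n : kron (kid m) (kid n) = kid (m * n).
Proof. by rewrite /kron /= tensmx11. Qed.

Lemma kron_mx m n (A : 'M[K]_m) (B : 'M[K]_n) :
  kron (tmx A) (tmx B) = tmx (A *t B).
Proof. by []. Qed.

Lemma kron_kid1 (u : sqmx) : kron u (kid 1) = u.
Proof.
case: u => m A; rewrite /kron /= tens_mx_scalar scale1r.
exact: tmx_cast.
Qed.

(** Lets a commutation be checked in whichever bracketing of the Kronecker product aligns the tensor
    factors of the two operators. *)
Lemma tmx_skew_commute (c : K) n m (A B : 'M[K]_n) (A' B' : 'M[K]_m) :
    tmx A = tmx A' -> tmx B = tmx B' ->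
    A' *m B' = c *: (B' *m A') ->
  A *m B = c *: (B *m A).
Proof.
move=> eA; have e : n = m := congr1 (@tag _ _) eA.
by case: _ / e A' B' eA => A' B' /tmx_inj-> /tmx_inj->.
Qed.

End KroneckerMonoid.

Lemma castmx_mulmx (K : pzRingType) n m (e : n = m) (A B : 'M[K]_n) :
  castmx (e, e) A *m castmx (e, e) B = castmx (e, e) (A *m B).
Proof. by case: _ / e; rewrite !castmx_id. Qed.

(** * Local copies on tensor powers *)

Section LocalCopy.
Variables (K : comPzRingType) (d n : nat).
Implicit Types (A B C D : 'M[K]_(d * d)) (i j : 'I_n.-1).

Lemma local_copyE A i : tmx (local_copy A i) =
  kron (kron (kid K (d ^ i)) (tmx A)) (kid K (d ^ (n - i - 2))).
Proof. exact: tmx_cast. Qed.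

Lemma local_copy1 i : local_copy (1%:M : 'M[K]_(d * d)) i = 1%:M.
Proof.
apply: tmx_inj; rewrite local_copyE !kron_kid; apply: congr1.
exact: local_copy_dim.
Qed.

Lemma local_copyM A B i :
  local_copy (A *m B) i = local_copy A i *m local_copy B i.
Proof. by rewrite /local_copy castmx_mulmx !tensmx_mul !mulmx1. Qed.

Lemma local_copyD A B i :
  local_copy (A + B) i = local_copy A i + local_copy B i.
Proof.
apply/matrixP=> k l; rewrite /local_copy !(mxE, castmxE) /=.
by rewrite mulrDr mulrDl.
Qed.

Lemma local_copyZ c A i : local_copy (c *: A) i = c *: local_copy A i.
Proof.
apply/matrixP=> k l; rewrite /local_copy !(mxE, castmxE) /=.
by rewrite mulrCA !mulrA.
Qed.

Lemma local_copy_far A B i j : (i.+1 < j)%N ->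
  local_copy A i *m local_copy B j = local_copy B j *m local_copy A i.
Proof.
move=> lt_ij; rewrite -[RHS]scale1r.
have ltj := ltn_ord j.
(* [A] occupies the factors i, i+1 and [B] the factors j, j+1, counted from 0: [k] factors lie
   between them and [s] after them. *)
pose k := (j - i - 2)%N; pose s := (n - j - 2)%N.
have ej : (j = i + 2 + k :> nat)%N by rewrite /k; lia.
have es : (n - i - 2 = k + (2 + s))%N by rewrite /s /k; lia.
pose A' := (1%:M : 'M[K]_(d ^ i)) *t A *t (1%:M : 'M[K]_(d ^ k)).
pose B' := B *t (1%:M : 'M[K]_(d ^ s)).
apply: (@tmx_skew_commute _ _ _ _ _ _ (A' *t (1%:M : 'M_(d * d * d ^ s)))
  ((1%:M : 'M_(d ^ i * (d * d) * d ^ k)) *t B')).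
- by rewrite local_copyE es !expnD -mulnn -kron_kid kronA.
- by rewrite local_copyE -/s ej !expnD -mulnn -kronA.
- by rewrite scale1r !tensmx_mul !mul1mx !mulmx1.
Qed.

(** The two supports share only the factor j, where [N] meets [P]; [M] and [Q] meet identities. *)
Lemma local_copy_adjacent (c : K) (M N P Q : 'M[K]_d) i j : j = i.+1 :> nat ->
    N *m P = c *: (P *m N) ->
  local_copy (M *t N) i *m local_copy (P *t Q) j =
    c *: (local_copy (P *t Q) j *m local_copy (M *t N) i).
Proof.
move=> ej NP; have ltj := ltn_ord j.
pose s := (n - j - 2)%N.
have es : (n - i - 2 = s.+1)%N by rewrite /s; lia.
pose I1 m : 'M[K]_m := 1%:M.
apply: (@tmx_skew_commute _ _ _ _ _ _
  (I1 (d ^ i)%N *t M *t N *t I1 d *t I1 (d ^ s)%N)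
  (I1 (d ^ i)%N *t I1 d *t P *t Q *t I1 (d ^ s)%N)).
- by rewrite local_copyE es expnS -kron_kid -!kron_mx !kronA.
- by rewrite local_copyE -/s ej expnSr -kron_kid -!kron_mx !kronA.
- rewrite !tensmx_mul !mul1mx !mulmx1 NP.
  apply/matrixP=> k l; rewrite !mxE; ring.
Qed.

End LocalCopy.

(** * Temperley-Lieb pairs and their braid operators *)

Section TemperleyLieb.
Variables (K : fieldType) (N : nat).
Implicit Types (a b : 'M[K]_N) (c w : K).

(** Dividing both elements by √3 gives the usual Temperley-Lieb relations with loop parameter √3;
    this scaling keeps √3 out of the coefficients. *)
Definition TLpair a b : Prop :=
  [/\ a *m a = 3 *: a, b *m b = 3 *: b,
      a *m b *m a = 3 *: a & b *m a *m b = 3 *: b].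

Lemma TLpair_sym a b : TLpair a b -> TLpair b a.
Proof. by case. Qed.

(** When a² = 3a, this acts as 1 + 2c on the image of [a] and as 1 - c on its kernel. *)
Definition theta c a : 'M[K]_N := (1 - c)%:M + c *: a.

Lemma comm_theta c a b : comm_mx a b -> comm_mx a (theta c b).
Proof.
move=> ab; apply: comm_mxD; first exact: comm_mx_scalar.
by rewrite /comm_mx -scalemxAl -scalemxAr ab.
Qed.

Lemma comm_theta2 c c' a b : comm_mx a b -> comm_mx (theta c a) (theta c' b).
Proof. by move=> ab; apply/comm_theta/comm_mx_sym/comm_theta/comm_mx_sym. Qed.

Lemma mul_theta c a b : a *m theta c b = (1 - c) *: a + c *: (a *m b).
Proof. by rewrite mulmxDr mul_mx_scalar -scalemxAr. Qed.

Lemma theta_mul p c a (b : 'M[K]_(N, p)) :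
  theta c a *m b = (1 - c) *: b + c *: (a *m b).
Proof. by rewrite mulmxDl mul_scalar_mx -scalemxAl. Qed.

Lemma mul_theta_id c a : a *m a = 3 *: a -> a *m theta c a = (1 + 2 * c) *: a.
Proof.
by move=> aa; rewrite mul_theta aa scalerA -scalerDl; congr (_ *: _); ring.
Qed.

(** The parameter drops out because 3(1 - c) + 3c = 3, so one statement serves a braid operator and
    its inverse. *)
Lemma theta_sandwich c a b : a *m a = 3 *: a -> a *m b *m a = 3 *: a ->
  a *m theta c b *m a = 3 *: a.
Proof.
move=> aa aba; rewrite mul_theta mulmxDl -!scalemxAl aa aba !scalerA -scalerDl.
by congr (_ *: _); ring.
Qed.

(** The constant term is (1 - w)(1 - w²) = 3, and the coefficient of [a] is w + w² + w³ = 0. *)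
Lemma theta_inv w a : w ^+ 2 = - w - 1 -> a *m a = 3 *: a ->
  theta w a *m theta (w ^+ 2) a = 3%:M.
Proof.
move=> hw aa; rewrite theta_mul mul_theta_id // scalerA /theta.
apply/matrixP=> k l; rewrite !mxE; ring: hw.
Qed.

(** After expansion the two sides differ by w((1 - w)² + 3w(1 - w) + 3w²)(a - b), and the bracket
    equals 1 + w + w² = 0. *)
Lemma theta_braid w a b : w ^+ 2 = - w - 1 -> TLpair a b ->
  theta w a *m theta w b *m theta w a = theta w b *m theta w a *m theta w b.
Proof.
move=> hw [aa bb aba bab].
rewrite !(theta_mul, mul_theta, mulmxDl, mulmxDr, =^~ scalemxAl) aa bb aba bab.
rewrite /theta.
move: (a *m b) (b *m a) => ab ba.
apply/matrixP=> k l; rewrite !mxE; ring: hw.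
Qed.

Definition bmw_elt c w a b : 'M[K]_N := (c / 3) *: (theta w a *m theta w b).

End TemperleyLieb.

(** * BMW relations from two commuting Temperley-Lieb families *)

Section BMWFromTL.
Variables (K : fieldType) (N : nat) (w r : K).
Hypotheses (hw : w ^+ 2 = - w - 1) (hr : r ^+ 2 = -1) (h3 : 3 != 0 :> K).
Implicit Types a b : 'M[K]_N.

Local Notation g := (bmw_elt r w).
Local Notation gV := (bmw_elt r^-1 (w ^+ 2)).
Local Notation e := (fun a b : 'M[K]_N => 3^-1 *: (a *m b)).

Let rV : r^-1 = - r.
Proof.
by apply: mulr1_eq; rewrite mulrN -expr2 hr opprK.
Qed.

Lemma bmw_eltV a b : a *m a = 3 *: a -> b *m b = 3 *: b -> comm_mx a b ->
  g a b *m gV a b = 1%:M /\ gV a b *m g a b = 1%:M.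
Proof.
move=> aa bb ab.
have ggV : g a b *m gV a b = 1%:M.
  rewrite /bmw_elt -scalemxAl -scalemxAr scalerA mulmxA.
  rewrite -(mulmxA (theta w a)) -(comm_theta2 _ _ ab) mulmxA theta_inv //.
  rewrite -mulmxA theta_inv // mul_scalar_mx scale_scalar_mx scale_scalar_mx.
  by congr _%:M; rewrite rV; field: hr.
by split=> //; apply: mulmx1C.
Qed.

(** As r^-1 = -r, the difference is r/3 times a sum of two products of thetas. There the constant
    term is (1 - w)² + (1 - w²)² = 3, the linear coefficients are w - w⁴ = 0, and [ab] has
    coefficient w² + w⁴ = -1. *)
Lemma bmw_elt_skein a b :
  g a b - gV a b = r *: (1%:M - e a b).
Proof.
rewrite /bmw_elt !(theta_mul, mul_theta) /theta rV.
move: (a *m b) => ab; apply/matrixP=> k l; rewrite !mxE.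
by field: hw.
Qed.

(** Each of [a] and [b] absorbs its theta factor as 1 + 2w, and (r/3)(1 + 2w)² = -r = r^-1. *)
Lemma bmw_elt_untwist a b : a *m a = 3 *: a -> b *m b = 3 *: b -> comm_mx a b ->
  e a b *m g a b = r^-1 *: e a b.
Proof.
move=> aa bb ab; rewrite /bmw_elt -scalemxAl -scalemxAr mulmxA.
rewrite -(mulmxA a) (comm_theta w (comm_mx_sym ab)) mulmxA mul_theta_id //.
rewrite -mulmxA -!scalemxAl mul_theta_id // -!scalemxAr !scalerA rV.
by congr (_ *: _); field: hw.
Qed.

(** Commutations regroup the product into one sandwich per Temperley-Lieb pair. Since neither value
    depends on [u], both signs of the exponent in the BMW relation are covered. *)
Lemma bmw_elt_sandwich c u a b a' b' :
    comm_mx a b -> comm_mx a' b' -> comm_mx a a' -> comm_mx b b' ->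
    TLpair a b' -> TLpair b a' ->
  e a b *m bmw_elt c u a' b' *m e a b = c *: e a b.
Proof.
move=> ab ab' aa bb [a2 _ aba _] [b2 _ bab _].
rewrite /bmw_elt -!(scalemxAl, scalemxAr) !scalerA.
have bc : comm_mx b (a *m theta u b' *m a).
  apply: comm_mxM (comm_mx_sym ab).
  by apply: comm_mxM (comm_mx_sym ab) _; apply: comm_theta.
have -> : a *m b *m (theta u a' *m theta u b') *m (a *m b) =
    (b *m theta u a' *m b) *m (a *m theta u b' *m a).
  rewrite -[RHS]mulmxA bc {1}ab !mulmxA -[_ *m a *m theta u a']mulmxA.
  by rewrite (comm_theta u aa) !mulmxA.
rewrite !theta_sandwich // -scalemxAl -scalemxAr -ab !scalerA.
by congr (_ *: _); field.
Qed.

Lemma bmw_elt_braid a b a' b' :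
    comm_mx a b -> comm_mx a' b' -> comm_mx a a' -> comm_mx b b' ->
    TLpair a b' -> TLpair b a' ->
  g a b *m g a' b' *m g a b = g a' b' *m g a b *m g a' b'.
Proof.
move=> ab ab' aa bb TLab TLba.
rewrite /bmw_elt -!(scalemxAl, scalemxAr) !scalerA; congr (_ *: _).
set P := theta w a; set Q := theta w b.
set P' := theta w a'; set Q' := theta w b'.
have PQ : comm_mx P Q by exact: comm_theta2.
have PQ' : comm_mx P' Q' by exact: comm_theta2.
have PP : comm_mx P P' by exact: comm_theta2.
have QQ : comm_mx Q Q' by exact: comm_theta2.
have braid : P *m Q' *m P = Q' *m P *m Q' by exact: theta_braid.
have braid' : Q *m P' *m Q = P' *m Q *m P' by exact: theta_braid.
have PX : comm_mx P (Q *m P' *m Q) by do 2?apply: comm_mxM.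
have QY : comm_mx Q' (P' *m Q *m P').
  by do 2?apply: comm_mxM; apply: comm_mx_sym.
(* PQ P'Q' PQ = (P Q' P) (Q P' Q): the two braid relations decouple. *)
transitivity ((P *m Q' *m P) *m (Q *m P' *m Q)).
  rewrite -[RHS]mulmxA PX PQ' {2}PQ !mulmxA.
  by rewrite -[P *m Q *m Q']mulmxA QQ !mulmxA.
rewrite braid braid' -[LHS]mulmxA QY {1}PQ' !mulmxA.
by rewrite -[Q' *m P' *m P]mulmxA -PP !mulmxA.
Qed.

End BMWFromTL.

(** * Weyl pairs produce Temperley-Lieb pairs *)

Lemma cube_root_neq1 (K : fieldType) (w : K) :
  3 != 0 :> K -> w ^+ 2 = - w - 1 -> w != 1.
Proof.
move=> h3 hw; apply: contraNneq h3 => w1.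
have -> : 3 = w ^+ 2 - (- w - 1) :> K by rewrite w1; ring.
by rewrite hw subrr.
Qed.

Lemma cube_root_sqr_neq1 (K : fieldType) (w : K) :
  3 != 0 :> K -> w ^+ 2 = - w - 1 -> w ^+ 2 != 1.
Proof.
move=> h3 hw; apply: contraNneq (cube_root_neq1 h3 hw) => w2.
have w3 : w ^+ 3 = 1 by ring: hw.
by apply/eqP; rewrite -[RHS]w3 exprSr w2 mul1r.
Qed.

Section WeylPairs.
Variables (K : fieldType) (N : nat).
Implicit Types (u v : 'M[K]_N) (c : K).

(** When u³ = 1 and 3 is invertible, this is three times a projection onto the vectors fixed by
    [u]. *)
Definition geom3 u : 'M[K]_N := 1%:M + u + u *m u.

Lemma mul_geom3 u : u *m u *m u = 1%:M -> u *m geom3 u = geom3 u.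
Proof.
move=> u3; rewrite /geom3 !mulmxDr mulmx1 mulmxA u3.
by rewrite [LHS]addrC addrA.
Qed.

Lemma geom3_mul u : u *m u *m u = 1%:M -> geom3 u *m u = geom3 u.
Proof.
move=> u3; rewrite /geom3 !mulmxDl mul1mx u3.
by rewrite [LHS]addrC addrA.
Qed.

Lemma geom3_idem u : u *m u *m u = 1%:M ->
  geom3 u *m geom3 u = 3 *: geom3 u.
Proof.
move=> u3; rewrite {1}/geom3 !mulmxDl mul1mx -mulmxA !mul_geom3 //.
by rewrite -!mulr2n -mulrSr scaler_nat.
Qed.

Lemma comm_geom3 u v : comm_mx u v -> comm_mx (geom3 u) (geom3 v).
Proof.
have comm_geom x y : comm_mx x y -> comm_mx x (geom3 y).
  move=> xy; apply: comm_mxD; last exact: comm_mxM.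
  by apply: comm_mxD => //; apply: comm_mx1.
by move=> uv; apply/comm_geom/comm_mx_sym/comm_geom/comm_mx_sym.
Qed.

(** A factor [u] taken out of the left [geom3 u] passes [v] at the cost of [c] and is absorbed on
    the right, so the product equals [c] times itself. *)
Lemma geom3_skew c u v : c != 1 -> u *m u *m u = 1%:M ->
  u *m v = c *: (v *m u) -> geom3 u *m v *m geom3 u = 0.
Proof.
move=> c1 u3 uv; set M := _ *m geom3 u.
have eM : M = c *: M.
  rewrite {1}/M -{1}(geom3_mul u3) -(mulmxA _ u) uv -scalemxAr -scalemxAl.
  by rewrite mulmxA -[_ *m u *m _]mulmxA mul_geom3.
have : (1 - c) *: M = 0 by rewrite scalerBl scale1r -eM subrr.
by move/eqP; rewrite scaler_eq0 subr_eq0 eq_sym (negbTE c1) => /eqP.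
Qed.

(** In 1 + v + v² only the term 1 survives: [v] and v² skew-commute with [u] by the nontrivial
    factors c and c². *)
Lemma geom3_sandwich c u v : c != 1 -> c ^+ 2 != 1 -> u *m u *m u = 1%:M ->
  u *m v = c *: (v *m u) -> geom3 u *m geom3 v *m geom3 u = 3 *: geom3 u.
Proof.
move=> c1 c2 u3 uv.
have uvv : u *m (v *m v) = c ^+ 2 *: (v *m v *m u).
  by rewrite mulmxA uv -scalemxAl -mulmxA uv -scalemxAr scalerA mulmxA expr2.
rewrite [geom3 v]/geom3 2!(mulmxDr (geom3 u)) mulmx1.
rewrite (mulmxDl (_ + _)) (mulmxDl (geom3 u)) geom3_idem //.
by rewrite (geom3_skew c1) // (geom3_skew c2) // !addr0.
Qed.

Lemma geom3_TLpair w u v : 3 != 0 :> K -> w ^+ 2 = - w - 1 ->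
    u *m u *m u = 1%:M -> v *m v *m v = 1%:M -> u *m v = w *: (v *m u) ->
  TLpair (geom3 u) (geom3 v).
Proof.
move=> h3 hw u3 v3 uv.
have w3 : w ^+ 3 = 1 by ring: hw.
have [w1 w2] := (cube_root_neq1 h3 hw, cube_root_sqr_neq1 h3 hw).
have vu : v *m u = w ^+ 2 *: (u *m v) by rewrite uv scalerA -exprSr w3 scale1r.
split; [exact: geom3_idem | exact: geom3_idem | |].
  exact: geom3_sandwich uv.
apply: geom3_sandwich vu => //.
(* With the roles exchanged the skew factor is w², and its square w⁴ = w is again different from
   1. *)
by rewrite -exprM (exprD w 3 1) w3 mul1r expr1.
Qed.

End WeylPairs.

(** * Shift and clock matrices *)

Section ShiftClock.
Variables (K : fieldType) (w : K).
Hypothesis hw : w ^+ 2 = - w - 1.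

Definition shift : 'M[K]_3 := \matrix_(i < 3, j < 3) (i == j + 1)%:R.
Definition clock : 'M[K]_3 := \matrix_(i < 3, j < 3) ((i == j)%:R * w ^+ j).
Definition shift2 : 'M[K]_3 := shift *m shift.

Lemma clock_shift : clock *m shift = w *: (shift *m clock).
Proof.
apply/matrixP=> i j.
rewrite !mxE !big_ord_recl !big_ord0 !mxE -!val_eqE /=.
case: i => [[|[|[|i]]] ?] //; case: j => [[|[|[|j]]] ?] //=; rewrite /bump /=.
all: try ring: hw.
Qed.

Lemma shift_cube : shift *m shift2 = 1%:M.
Proof.
apply/matrixP=> i j; rewrite !mxE.
rewrite !big_ord_recl !big_ord0 !mxE !big_ord_recl !big_ord0 !mxE -!val_eqE /=.
case: i => [[|[|[|i]]] ?] //; case: j => [[|[|[|j]]] ?] //=; rewrite /bump /=.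
all: ring.
Qed.

Lemma clock_cube : clock *m clock *m clock = 1%:M.
Proof.
apply/matrixP=> i j; rewrite !mxE.
rewrite !big_ord_recl !big_ord0 !mxE !big_ord_recl !big_ord0 !mxE -!val_eqE /=.
case: i => [[|[|[|i]]] ?] //; case: j => [[|[|[|j]]] ?] //=; rewrite /bump /=.
all: ring: hw.
Qed.

End ShiftClock.

Lemma skew_scale (K : comPzRingType) N (a b c : K) (u v : 'M[K]_N) :
  u *m v = c *: (v *m u) -> (a *: u) *m (b *: v) = c *: ((b *: v) *m (a *: u)).
Proof.
move=> uv; rewrite -!(scalemxAl, scalemxAr) uv !scalerA.
by congr (_ *: _); ring.
Qed.

Section LocalCopyPolynomials.
Variables (K : fieldType) (d n : nat).
Implicit Types (u a b : 'M[K]_(d * d)) (i : 'I_n.-1).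

Lemma local_copy_geom3 u i : local_copy (geom3 u) i = geom3 (local_copy u i).
Proof. by rewrite /geom3 !local_copyD local_copyM local_copy1. Qed.

Lemma local_copy_theta c a i :
  local_copy (theta c a) i = theta c (local_copy a i).
Proof.
rewrite /theta local_copyD local_copyZ -!(scalemx1 _ (1 - c)).
by rewrite local_copyZ local_copy1.
Qed.

Lemma local_copy_bmw_elt c w a b i : local_copy (bmw_elt c w a b) i =
  bmw_elt c w (local_copy a i) (local_copy b i).
Proof. by rewrite /bmw_elt local_copyZ local_copyM !local_copy_theta. Qed.

End LocalCopyPolynomials.

(** * The hopping and charge operators and the BMW images *)

Section PottsOperators.
Variables (K : fieldType) (w : K).
Hypotheses (h3 : 3 != 0 :> K) (hw : w ^+ 2 = - w - 1).

Let w3 : w ^+ 3 = 1. Proof. by ring: hw. Qed.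
Local Notation X := (shift K).
Local Notation X2 := (shift2 K).
Local Notation Z := (clock w).

(** The scalar w leaves the cube equal to 1 and gives 1 + wU + wU² the coefficients 1, w², 1, that
    is w^(t²+t), on the powers t = 0, 1, 2 of X ⊗ X². *)
Definition hop : 'M[K]_(3 * 3) := w *: (X *t X2).
Definition charge : 'M[K]_(3 * 3) := w *: (Z *t Z).
Definition pottsA : 'M[K]_(3 * 3) := geom3 hop.
Definition pottsB : 'M[K]_(3 * 3) := geom3 charge.

Lemma clock_shift2 : Z *m X2 = w ^+ 2 *: (X2 *m Z).
Proof.
rewrite /shift2 mulmxA clock_shift // -scalemxAl -mulmxA clock_shift //.
by rewrite -scalemxAr scalerA mulmxA.
Qed.

Lemma shift2_clock : X2 *m Z = w *: (Z *m X2).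
Proof. by rewrite clock_shift2 scalerA -exprS w3 scale1r. Qed.

Lemma cube_scale_tens (P Q : 'M[K]_3) :
    P *m P *m P = 1%:M -> Q *m Q *m Q = 1%:M ->
  let u := w *: (P *t Q) in u *m u *m u = 1%:M.
Proof.
move=> P3 Q3 u; rewrite /u -!(scalemxAl, scalemxAr) !scalerA !tensmx_mul P3 Q3.
by rewrite tensmx11 -[RHS]scale1r; congr (_ *: _); ring: hw.
Qed.

Lemma hop_cube : hop *m hop *m hop = 1%:M.
Proof.
apply: cube_scale_tens; first by rewrite -mulmxA shift_cube.
by rewrite {1}/shift2 -(mulmxA X X X2) shift_cube mulmx1 shift_cube.
Qed.

Lemma charge_cube : charge *m charge *m charge = 1%:M.
Proof. by apply: cube_scale_tens; rewrite clock_cube. Qed.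

(** Moving the clock past X costs w and past X² costs w²; over the two tensor factors these
    cancel. *)
Lemma hop_charge : comm_mx hop charge.
Proof.
rewrite /comm_mx -[RHS]scale1r; apply: skew_scale; rewrite scale1r.
rewrite !tensmx_mul clock_shift // shift2_clock.
by apply/matrixP=> k l; rewrite !mxE; ring.
Qed.

Section Sites.
Variable n : nat.
Implicit Types i j : 'I_n.-1.
Local Notation a := (local_copy pottsA).
Local Notation b := (local_copy pottsB).

Lemma local_cube (u : 'M[K]_(3 * 3)) i : u *m u *m u = 1%:M ->
  local_copy u i *m local_copy u i *m local_copy u i = 1%:M.
Proof. by move=> u3; rewrite -!local_copyM u3 local_copy1. Qed.

Lemma potts_comm i : comm_mx (a i) (b i).
Proof. by rewrite /comm_mx -!local_copyM (comm_geom3 hop_charge). Qed.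

Lemma potts_idem i : a i *m a i = 3 *: a i /\ b i *m b i = 3 *: b i.
Proof.
rewrite !local_copy_geom3.
by split; apply/geom3_idem/local_cube; [exact: hop_cube|exact: charge_cube].
Qed.

(** Everything is decided at the shared factor: X² meets X and Z meets Z in the commuting cases,
    while X² meets Z and Z meets X in the Weyl pairs, both with skew factor w. *)
Lemma potts_next i j : j = i.+1 :> nat ->
  [/\ comm_mx (a i) (a j), comm_mx (b i) (b j),
      TLpair (a i) (b j) & TLpair (b i) (a j)].
Proof.
move=> ij; rewrite !local_copy_geom3.
have [h3' c3] := (hop_cube, charge_cube).
split; [apply: comm_geom3|apply: comm_geom3|apply: (geom3_TLpair h3 hw)|
        apply: (geom3_TLpair h3 hw)]; try exact: local_cube.
- rewrite /comm_mx -[RHS]scale1r !local_copyZ.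
  apply/skew_scale/local_copy_adjacent => //.
  by rewrite scale1r /shift2 mulmxA.
- rewrite /comm_mx -[RHS]scale1r !local_copyZ.
  apply/skew_scale/local_copy_adjacent => //.
  by rewrite scale1r.
- rewrite !local_copyZ; apply/skew_scale/local_copy_adjacent => //.
  exact: shift2_clock.
- rewrite !local_copyZ; apply/skew_scale/local_copy_adjacent => //.
  exact: clock_shift.
Qed.

Lemma potts_adjacent i j : adjacent i j ->
  [/\ comm_mx (a i) (a j), comm_mx (b i) (b j),
      TLpair (a i) (b j) & TLpair (b i) (a j)].
Proof.
case/orP=> /eqP/potts_next[aa bb ab ba]; first by split.
by split; [exact: comm_mx_sym|exact: comm_mx_sym|exact: TLpair_sym|
  exact: TLpair_sym].
Qed.

End Sites.

Variable r : K.
Hypothesis hr : r ^+ 2 = -1.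

Definition bmwG : 'M[K]_(3 * 3) := bmw_elt r w pottsA pottsB.
Definition bmwGV : 'M[K]_(3 * 3) := bmw_elt r^-1 (w ^+ 2) pottsA pottsB.
Definition bmwE : 'M[K]_(3 * 3) := 3^-1 *: (pottsA *m pottsB).

Lemma local_bmwG n (i : 'I_n.-1) : local_copy bmwG i =
  bmw_elt r w (local_copy pottsA i) (local_copy pottsB i).
Proof. exact: local_copy_bmw_elt. Qed.

Lemma local_bmwGV n (i : 'I_n.-1) : local_copy bmwGV i =
  bmw_elt r^-1 (w ^+ 2) (local_copy pottsA i) (local_copy pottsB i).
Proof. exact: local_copy_bmw_elt. Qed.

Lemma local_bmwE n (i : 'I_n.-1) : local_copy bmwE i =
  3^-1 *: (local_copy pottsA i *m local_copy pottsB i).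
Proof. by rewrite local_copyZ local_copyM. Qed.

Definition bmw_image n (x : bmw_gen n) : 'M[K]_(3 ^ n) :=
  match x with
  | Bg i => local_copy bmwG i
  | BgV i => local_copy bmwGV i
  | Be i => local_copy bmwE i
  end.

Lemma bmwE_idem : bmwE *m bmwE = 3 *: bmwE.
Proof.
have pAB : comm_mx pottsA pottsB by apply/comm_geom3/hop_charge.
have A2 : pottsA *m pottsA = 3 *: pottsA by apply/geom3_idem/hop_cube.
have B2 : pottsB *m pottsB = 3 *: pottsB by apply/geom3_idem/charge_cube.
rewrite /bmwE -!(scalemxAl, scalemxAr) mulmxA -(mulmxA pottsA) -pAB mulmxA A2.
rewrite -mulmxA B2 -!(scalemxAl, scalemxAr) !scalerA.
by congr (_ *: _); field.
Qed.

Lemma bmw_image_rel (q : K) : q - q^-1 = r -> forall n u v,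
  @bmw_rel K r q n u v ->
  term_eval (@bmw_image n) u = term_eval (@bmw_image n) v.
Proof.
move=> hq n u v; case: u v / => [i|i|i j ij|i j|i|i|i j ij|i j ij] /=.
- rewrite local_bmwG local_bmwGV; have [aa bb] := potts_idem i.
  by case: (bmw_eltV hw hr h3 aa bb (potts_comm i)).
- rewrite local_bmwG local_bmwGV; have [aa bb] := potts_idem i.
  by case: (bmw_eltV hw hr h3 aa bb (potts_comm i)).
- rewrite !local_bmwG; have [aa bb ab ba] := potts_adjacent ij.
  exact: (bmw_elt_braid _ hw (potts_comm i) (potts_comm j) aa bb ab ba).
- exact: local_copy_far.
- rewrite hq local_bmwG local_bmwGV local_bmwE.
  exact: (bmw_elt_skein hw hr h3).
- rewrite local_bmwG local_bmwE; have [aa bb] := potts_idem i.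
  exact: (bmw_elt_untwist hw hr h3 aa bb (potts_comm i)).
- rewrite local_bmwG !local_bmwE; have [aa bb ab ba] := potts_adjacent ij.
  exact: (bmw_elt_sandwich h3 _ _ (potts_comm i) (potts_comm j) aa bb ab ba).
- rewrite local_bmwGV !local_bmwE; have [aa bb ab ba] := potts_adjacent ij.
  exact: (bmw_elt_sandwich h3 _ _ (potts_comm i) (potts_comm j) aa bb ab ba).
Qed.

End PottsOperators.

(** * Traces and the addition of a strand *)

Lemma castmx1 (K : pzRingType) n m (e : n = m) :
  castmx (e, e) (1%:M : 'M[K]_n) = 1%:M.
Proof. by case: _ / e; rewrite castmx_id. Qed.

Lemma mxtrace_castmx (K : pzRingType) n m (e : n = m) (A : 'M[K]_n) :
  \tr (castmx (e, e) A) = \tr A.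
Proof. by case: _ / e; rewrite castmx_id. Qed.

Lemma mxtrace_tens (K : pzRingType) m n (A : 'M[K]_m) (B : 'M[K]_n) :
  \tr (A *t B) = \tr A * \tr B.
Proof. by rewrite /mxtrace mulr_sum; apply: eq_bigr => i _; rewrite !mxE. Qed.

(** Conjugation by [u] multiplies [M] by [c] but preserves its trace. *)
Lemma mxtrace_skew (K : fieldType) N (c : K) (u v M : 'M[K]_N) :
  c != 1 -> u *m v = 1%:M -> u *m M = c *: (M *m u) -> \tr M = 0.
Proof.
move=> c1 uv uM; have : \tr (u *m M *m v) = c * \tr M.
  by rewrite uM -scalemxAl -mulmxA uv mulmx1 mxtraceZ.
rewrite mxtrace_mulC mulmxA (mulmx1C uv) mul1mx => eM.
apply/eqP; rewrite -(mulrI_eq0 _ (mulfI (_ : 1 - c != 0))).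
  by rewrite mulrBl mul1r -eM subrr.
by rewrite subr_eq0 eq_sym.
Qed.

Section Stabilization.
Variables (K : comPzRingType) (d : nat).

Definition add_strand n (M : 'M[K]_(d ^ n)) : 'M[K]_(d ^ n.+1) :=
  castmx (esym (expnSr d n), esym (expnSr d n)) (M *t 1%:M).

Lemma add_strand_mul n (A B : 'M[K]_(d ^ n)) :
  add_strand (A *m B) = add_strand A *m add_strand B.
Proof. by rewrite /add_strand castmx_mulmx tensmx_mul mulmx1. Qed.

Lemma add_strand1 n : add_strand (1%:M : 'M[K]_(d ^ n)) = 1%:M.
Proof. by rewrite /add_strand tensmx11 castmx1. Qed.

Lemma add_strand_add n (A B : 'M[K]_(d ^ n)) :
  add_strand (A + B) = add_strand A + add_strand B.
Proof.
by apply/matrixP=> k l; rewrite /add_strand !(mxE, castmxE) mulrDl.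
Qed.

Lemma add_strand_scale n c (A : 'M[K]_(d ^ n)) :
  add_strand (c *: A) = c *: add_strand A.
Proof.
by apply/matrixP=> k l; rewrite /add_strand !(mxE, castmxE) mulrA.
Qed.

Lemma local_copy_widen n (A : 'M[K]_(d * d)) (i : 'I_n.-1) :
  local_copy A (widen_ord (leq_pred n) i : 'I_n.+1.-1) =
  add_strand (local_copy A i).
Proof.
have lti := ltn_ord i; apply: tmx_inj; rewrite local_copyE tmx_cast -kron_mx.
have -> : (n.+1 - widen_ord (leq_pred n) i - 2 = (n - i - 2).+1)%N.
  by rewrite /=; lia.
by rewrite local_copyE expnSr -kron_kid kronA.
Qed.

(** This is the partial trace over the last factor; what remains is Y = 1 ⊗ C, whose form matters
    below only when C = 1. *)
Lemma trace_local_copy_last m (X : 'M[K]_(d ^ m.+1)) (C D : 'M[K]_d) :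
  exists2 Y, C = 1%:M -> Y = 1%:M &
    \tr (add_strand X *m local_copy (C *t D) (ord_max : 'I_m.+2.-1)) =
    \tr (X *m Y) * \tr D.
Proof.
pose e := esym (expnSr d m).
pose Y := castmx (e, e) ((1%:M : 'M[K]_(d ^ m)) *t C); exists Y.
  by rewrite /Y => ->; rewrite tensmx11 castmx1.
have -> : local_copy (C *t D) (ord_max : 'I_m.+2.-1) =
    castmx (esym (expnSr d m.+1), esym (expnSr d m.+1)) (Y *t D).
  apply: tmx_inj; rewrite local_copyE tmx_cast -!kron_mx /Y tmx_cast.
  have -> : (m.+2 - (ord_max : 'I_m.+1) - 2 = 0)%N by rewrite /=; lia.
  by rewrite expn0 kron_kid1 kronA.
by rewrite castmx_mulmx tensmx_mul mul1mx mxtrace_castmx mxtrace_tens.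
Qed.

End Stabilization.

(** Under the representations, the inclusion of C_n in C_{n+1} becomes M ↦ M ⊗ 1. *)
Lemma term_eval_widen (K : fieldType) (w r : K) n u :
  term_eval (@bmw_image K w r n.+1) (term_map (@bmw_gen_widen n) u) =
  add_strand (term_eval (@bmw_image K w r n) u).
Proof.
elim: u => /= [[]i|||u ->|u -> v ->|u -> v ->|a u ->];
  try exact: local_copy_widen.
- by rewrite -(scale0r (0 : 'M[K]_(3 ^ n))) add_strand_scale scale0r.
- by rewrite add_strand1.
- by rewrite -!scaleN1r add_strand_scale.
- by rewrite add_strand_add.
- by rewrite add_strand_mul.
- by rewrite add_strand_scale.
Qed.

(** * The Markov property through partial traces *)

Section PartialTrace.
Variables (K : fieldType) (w : K).
Hypotheses (h3 : 3 != 0 :> K) (hw : w ^+ 2 = - w - 1).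
Variables (m : nat) (X : 'M[K]_(3 ^ m.+1)).
Local Notation last_tr M :=
  (\tr (add_strand X *m local_copy M (ord_max : 'I_m.+2.-1))).
Local Notation T := (shift2 K).
Local Notation Z := (clock w).

Lemma last_trD M M' : last_tr (M + M') = last_tr M + last_tr M'.
Proof. by rewrite local_copyD mulmxDr mxtraceD. Qed.

Lemma last_trZ c M : last_tr (c *: M) = c * last_tr M.
Proof. by rewrite local_copyZ -scalemxAr mxtraceZ. Qed.

Lemma last_tr1 : last_tr 1%:M = 3 * \tr X.
Proof.
have [Y eY] := trace_local_copy_last X 1%:M 1%:M.
by rewrite eY // mulmx1 tensmx11 mxtrace1 mulrC.
Qed.

Lemma last_tr_tens0 c P Q : \tr Q = 0 -> last_tr (c *: (P *t Q)) = 0.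
Proof.
have [Y _] := trace_local_copy_last X P Q.
by rewrite last_trZ => -> ->; rewrite !mulr0.
Qed.

Let w3 : w ^+ 3 = 1. Proof. by ring: hw. Qed.
Let w1 : w != 1. Proof. exact: cube_root_neq1. Qed.

Lemma trace_clock : \tr Z = 0 /\ \tr (Z *m Z) = 0.
Proof.
have XZ : shift K *m Z = w ^+ 2 *: (Z *m shift K).
  by rewrite clock_shift // scalerA -exprSr w3 scale1r.
split; first exact: (mxtrace_skew (cube_root_sqr_neq1 h3 hw) (shift_cube K) XZ).
apply: (mxtrace_skew w1 (shift_cube K)).
rewrite mulmxA XZ -scalemxAl -mulmxA XZ -scalemxAr scalerA mulmxA.
by congr (_ *: _); ring: hw.
Qed.

(** Conjugation by the clock fixes [Q] and multiplies the two products by w² and w⁴ = w, neither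
    equal to 1. *)
Lemma trace_shift2_mul (Q : 'M[K]_3) : comm_mx Z Q ->
  \tr (T *m Q) = 0 /\ \tr (T *m T *m Q) = 0.
Proof.
have ZV : Z *m (Z *m Z) = 1%:M by rewrite mulmxA clock_cube.
move: (shift2 K) (clock_shift2 hw) => S ZS ZQ.
split; [apply: (mxtrace_skew (cube_root_sqr_neq1 h3 hw) ZV)|
        apply: (mxtrace_skew w1 ZV)].
  by rewrite mulmxA ZS -scalemxAl -!mulmxA ZQ.
rewrite !mulmxA ZS -!scalemxAl -(mulmxA S Z) ZS -!scalemxAr -!scalemxAl scalerA.
rewrite -!mulmxA ZQ; congr (_ *: _); ring: hw.
Qed.

(** The nontrivial terms of [pottsA] put T or T² in front of [Q] in the last factor, hence a
    traceless matrix. *)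
Lemma last_tr_pottsA_mul c P Q : comm_mx Z Q ->
  last_tr (pottsA w *m (c *: (P *t Q))) = last_tr (c *: (P *t Q)).
Proof.
move=> /trace_shift2_mul[t1 t2].
have -> : pottsA w *m (c *: (P *t Q)) = c *: (P *t Q) +
    ((c * w) *: ((shift K *m P) *t (T *m Q)) +
     (c * w ^+ 2) *: ((shift K *m shift K *m P) *t (T *m T *m Q))).
  rewrite addrA mulmxDl mulmxDl mul1mx /hop -!(scalemxAl, scalemxAr).
  by rewrite !scalerA !tensmx_mul expr2 !mulrA (mulrC w c).
rewrite last_trD -[RHS]addr0; congr (_ + _).
by rewrite last_trD last_tr_tens0 // add0r last_tr_tens0.
Qed.

Lemma last_tr_pottsA : last_tr (pottsA w) = 3 * \tr X.
Proof.
have := last_tr_pottsA_mul 1 1%:M (comm_mx1 Z).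
by rewrite scale1r tensmx11 mulmx1 last_tr1.
Qed.

Let pottsB_expand : pottsB w = 1%:M + (w *: (Z *t Z) +
  w ^+ 2 *: ((Z *m Z) *t (Z *m Z))).
Proof.
rewrite addrA /pottsB /geom3 /charge -scalemxAl -scalemxAr scalerA.
by rewrite tensmx_mul.
Qed.

Lemma last_tr_pottsB : last_tr (pottsB w) = 3 * \tr X.
Proof.
have [t1 t2] := trace_clock.
rewrite pottsB_expand last_trD last_tr1 -[RHS]addr0; congr (_ + _).
by rewrite last_trD last_tr_tens0 // add0r last_tr_tens0.
Qed.

Lemma last_tr_pottsAB : last_tr (pottsA w *m pottsB w) = 3 * \tr X.
Proof.
rewrite -last_tr_pottsB pottsB_expand !mulmxDr mulmx1 last_trD [RHS]last_trD.
congr (_ + _); first by rewrite last_tr_pottsA last_tr1.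
rewrite last_trD [RHS]last_trD; congr (_ + _); apply: last_tr_pottsA_mul => //.
exact: comm_mxM.
Qed.

(** The elements 1, A, B and AB all have the value 3 tr X, so the product of thetas contributes 3((1
    - u) + u)² tr X. The absence of [u] from the result covers both g and its inverse. *)
Lemma last_tr_bmw_elt c u :
  last_tr (bmw_elt c u (pottsA w) (pottsB w)) = c * \tr X.
Proof.
rewrite /bmw_elt theta_mul mul_theta /theta -(scalemx1 _ (1 - u)).
move: (pottsA w) (pottsB w) last_tr_pottsA last_tr_pottsB last_tr_pottsAB.
move=> A B phiA phiB phiAB.
rewrite last_trZ last_trD last_trZ (last_trD ((1 - u) *: _)) last_trZ last_tr1.
rewrite last_trZ phiB.
rewrite last_trZ last_trD last_trZ phiA last_trZ phiAB.
by field.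
Qed.

Lemma last_tr_bmwE : last_tr (bmwE w) = \tr X.
Proof. by rewrite last_trZ last_tr_pottsAB mulKf. Qed.

End PartialTrace.

(** * Arithmetic of the twelfth root of unity *)

Section Constants.
Variable R : realType.
Local Open Scope complex_scope.
Local Notation q := (qB R).

Lemma expiD s t : expi (s + t) = expi s * expi t :> R[i].
Proof.
by rewrite /expi cosD sinD; apply/eqP; rewrite eq_complex /= eqxx addrC eqxx.
Qed.

Lemma cos_pi6_gt0 : 0 < cos (pi / 6 : R).
Proof.
have pi0 := @pi_gt0 R; apply: cos_gt0_pihalf; apply/andP; split.
  by rewrite (lt_trans (y := 0)) ?oppr_lt0 ?divr_gt0.
by rewrite ltr_pM2l // ltf_pV2 ?posrE // ltr_nat.
Qed.

(* q^6 = -1, and the factor q^2 + 1 is excluded because Re q > 0. *)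
Lemma qB_quartic : q ^+ 4 = q ^+ 2 - 1.
Proof.
have q3 : q ^+ 3 = 'i by rewrite -rB_eq_i.
have q6 : (q ^+ 2 + 1) * (q ^+ 4 - q ^+ 2 + 1) = 0.
  transitivity (q ^+ 3 * q ^+ 3 + 1); first by ring.
  by rewrite q3 -expr2 sqr_i addNr.
move/eqP: q6; rewrite mulf_eq0 => /orP[|/eqP h]; last first.
  by apply/eqP; rewrite -subr_eq0 -h; apply/eqP; ring.
rewrite addr_eq0 => /eqP q2; move: q3; rewrite exprS q2 mulrN1 => -[] /eqP.
by rewrite oppr_eq0 gt_eqF // cos_pi6_gt0.
Qed.

Lemma omega3E : omega3 R = q ^+ 4.
Proof.
by rewrite /omega3 /qB !exprS expr0 mulr1 -!expiD; congr expi; field.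
Qed.

Lemma omega3_quadratic : omega3 R ^+ 2 = - omega3 R - 1.
Proof. by rewrite omega3E qB_quartic; ring: qB_quartic. Qed.

Lemma rB_sqr : rB R ^+ 2 = -1.
Proof. by rewrite rB_eq_i sqr_i. Qed.

Lemma qB_inv : q^-1 = q - q ^+ 3.
Proof.
have qq : q * (q - q ^+ 3) = 1 by ring: qB_quartic.
by rewrite (mulr1_eq qq).
Qed.

Lemma qB_subV : q - q^-1 = rB R.
Proof. by rewrite qB_inv /rB; ring. Qed.

(** The right side is q + q^-1 = 2 cos(π/6), which is positive with square 3. This makes the
    normalization of R_3 a polynomial in q, to be reduced by q⁴ = q² - 1. *)
Lemma sqrt3E : (Num.sqrt 3)%:C = 2 * q - q ^+ 3.
Proof.
pose c : R := cos (pi / 6).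
have qc : 2 * q - q ^+ 3 = (2 * c)%:C.
  transitivity (q + q^-1); first by rewrite qB_inv; ring.
  have -> : q^-1 = c -i* sin (pi / 6).
    have qq : q * (c -i* sin (pi / 6)) = 1.
      apply/eqP; rewrite eq_complex /= mulrN opprK -!expr2 cos2Dsin2 eqxx /=.
      by rewrite /c mulrN (mulrC (sin _)) addNr.
    by rewrite (mulr1_eq qq).
  by apply/eqP; rewrite eq_complex /= subrr eqxx andbT mulr_natl mulr2n.
have c2 : (2 * c) ^+ 2 = 3.
  apply: (@complexI R); rewrite rmorphXn /= -qc rmorph_nat; ring: qB_quartic.
by rewrite qc -c2 sqrtr_sqr ger0_norm // mulr_ge0 // ltW // cos_pi6_gt0.
Qed.
End Constants.

(** * Factorization of the Gauss sums on basis vectors *)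

Lemma tensmx_scale (K : comPzRingType) m n p s (a b : K)
    (A : 'M[K]_(m, n)) (B : 'M[K]_(p, s)) :
  (a *: A) *t (b *: B) = (a * b) *: (A *t B).
Proof. by apply/matrixP=> i j; rewrite !mxE; ring. Qed.

Section PottsAction.
Variables (K : fieldType) (w : K).
Hypotheses (h3 : 3 != 0 :> K) (hw : w ^+ 2 = - w - 1).
Local Notation e x := (delta_mx x 0 : 'cV[K]_3).
Implicit Types x y : 'F_3.

Lemma delta_tens x y : e x *t e y = delta_mx (mxtens_index (x, y)) 0.
Proof.
apply/matrixP=> i j; case: (mxtens_indexP i) => a b; rewrite !mxE.
rewrite mxtens_indexK [j]ord1 (can_eq (@mxtens_indexK _ _)) xpair_eqE.
by rewrite !ord1 /= !andbT -natrM mulnb.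
Qed.

Lemma tens_basis_ext (M M' : 'M[K]_(3 * 3)) :
  (forall x y, M *m (e x *t e y) = M' *m (e x *t e y)) -> M = M'.
Proof.
move=> eqM; apply/matrixP=> i j; case: (mxtens_indexP j) => x y.
have := congr1 (fun v : 'cV_(3 * 3) => v i 0) (eqM x y).
by rewrite delta_tens -!colE !mxE.
Qed.

Lemma shift_delta x : shift K *m e x = e (x + 1).
Proof. by rewrite -colE; apply/matrixP=> i j; rewrite !mxE [j]ord1 andbT. Qed.

Lemma clock_delta x : clock w *m e x = w ^+ x *: e x.
Proof.
rewrite -colE; apply/matrixP=> i j; rewrite !mxE [j]ord1 andbT; exact: mulrC.
Qed.

Lemma hop_delta x y : hop w *m (e x *t e y) = w *: (e (x + 1) *t e (y + 1 + 1)).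
Proof.
by rewrite /hop -scalemxAl tensmx_mul /shift2 -mulmxA !shift_delta.
Qed.

Lemma charge_delta x y :
  charge w *m (e x *t e y) = w ^+ (x + y).+1 *: (e x *t e y).
Proof.
rewrite /charge -scalemxAl tensmx_mul !clock_delta tensmx_scale scalerA.
by rewrite exprS exprD.
Qed.

Lemma theta_pottsB_delta x y : theta w (pottsB w) *m (e x *t e y) =
  (1 + w * w ^+ (x + y).+1 + w * w ^+ (x + y).+1 ^+ 2) *: (e x *t e y).
Proof.
rewrite theta_mul /pottsB /geom3 2!mulmxDl mul1mx -mulmxA charge_delta.
rewrite -scalemxAr charge_delta !scalerA.
move: (w ^+ _) (e x *t e y) => c v.
rewrite -{2}(scale1r v) -!scalerDl scalerA -scalerDl.
by congr (_ *: _); ring.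
Qed.

Lemma theta_pottsA_delta x y : theta w (pottsA w) *m (e x *t e y) =
  e x *t e y + w ^+ 2 *: (e (x + 1) *t e (y + 1 + 1)) +
    e (x + 1 + 1) *t e (y + 1 + 1 + 1 + 1).
Proof.
rewrite theta_mul /pottsA /geom3 2!mulmxDl mul1mx -mulmxA hop_delta.
rewrite -scalemxAr hop_delta !scalerA.
move: (e x *t e y) (e (x + 1) *t _) (e (x + 1 + 1) *t _) => u v v'.
rewrite !scalerDr addrA addrA -scalerDl !scalerA subrK scale1r expr2.
by rewrite (_ : w * (w * w) = 1) ?scale1r //; ring: hw.
Qed.

(** The A-factor supplies the coefficients w^(t²+t). The B-factor is diagonal with eigenvalue (1 -
    w) w^(s-s²), s = x + y. The remaining scalars agree because 2q - q³ = q(1 - w) has square 3. *)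
Lemma potts_image (q : K) x y : q ^+ 4 = q ^+ 2 - 1 -> w = q ^+ 4 ->
  q ^+ 2 *: ((2 * q - q ^+ 3)^-1 *:
    \sum_(t : 'F_3) w ^+ R3_exponent x y t *: (e (x + t) *t e (y - t))) =
  bmw_elt (q ^+ 3) w (pottsA w) (pottsB w) *m (e x *t e y).
Proof.
move=> hq wq.
rewrite /bmw_elt -scalemxAl -mulmxA theta_pottsB_delta.
rewrite -scalemxAr theta_pottsA_delta.
have -> : (2 * q - q ^+ 3)^-1 = (2 * q - q ^+ 3) / 3.
  have s2 : (2 * q - q ^+ 3) ^+ 2 = 3 by ring: hq.
  by apply: mulr1_eq; rewrite mulrA -expr2 s2 divff.
(* X² shifts the second factor by 2 = -1, so y - t has to appear as 2t increments. *)
have f3E (z : 'F_3) : [/\ z - 1 = z + 1 + 1 & z - (1 + 1) = z + 1 + 1 + 1 + 1].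
  by case: z => [[|[|[|z]]] ltz] //; split; apply: val_inj.
rewrite !big_ord_recl big_ord0.
have -> : lift ord0 ord0 = 1 :> 'F_3 by apply: val_inj.
have -> : lift ord0 (lift ord0 ord0) = 1 + 1 :> 'F_3 by apply: val_inj.
have -> : ord0 = 0 :> 'F_3 by apply: val_inj.
have [-> ->] := f3E y; rewrite oppr0 !addr0 !addrA.
move: (e x *t e y) (e (x + 1) *t _) (e (x + 1 + 1) *t _) => u v v'.
rewrite !scalerDr !scalerA wq.
have lin3 a b c a' b' c' : a = a' -> b = b' -> c = c' ->
  a *: u + b *: v + c *: v' = a' *: u + b' *: v + c' *: v' by move=> -> -> ->.
apply: lin3; rewrite /R3_exponent.
(* The exponents are residues used as natural numbers; on each of the nine pairs they become
   explicit numerals. *)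
all: case: x y => [[|[|[|x]]] ltx] [[|[|[|y]]] lty] //=.
all: by field: hq.
Qed.
End PottsAction.

(** * Identification of G and E *)

Section YangBaxterOperator.
Variable R : realType.
Local Notation K := R[i].
Local Notation w := (omega3 R).
Local Notation r := (rB R).

Let h3 : 3 != 0 :> K. Proof. by rewrite pnatr_eq0. Qed.
Let hw := omega3_quadratic R.

Lemma R3_basis (x y : 'F_3) :
  R3 R *m (ebasis R x *t ebasis R y) = R3_image R x y.
Proof.
rewrite delta_tens -colE; apply/matrixP=> i j.
by rewrite mxE [LHS]mxE mxtens_indexK [j]ord1.
Qed.

Lemma GopE : Gop R = bmwG w r.
Proof.
apply: tens_basis_ext => x y.
rewrite -(potts_image h3 hw x y (qB_quartic R) (omega3E R)) -sqrt3E.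
by rewrite /Gop -scalemxAl R3_basis.
Qed.

(** The skein relation is solved for E, with (q - q^-1)^-1 = r^-1 cancelling the factor r. *)
Lemma EopE : Eop R = bmwE w.
Proof.
have A2 : pottsA w *m pottsA w = 3 *: pottsA w by apply/geom3_idem/hop_cube.
have B2 : pottsB w *m pottsB w = 3 *: pottsB w by apply/geom3_idem/charge_cube.
have AB : comm_mx (pottsA w) (pottsB w) by apply/comm_geom3/hop_charge.
have [GV _] := bmw_eltV hw (rB_sqr R) h3 A2 B2 AB.
(* [invmx] is a genuine inverse only on units, so invertibility is first extracted from the explicit
   inverse. *)
have invG : invmx (Gop R) = bmwGV w r.
  have [uG _] := mulmx1_unit GV.
  by rewrite GopE -[LHS]mulmx1 -GV mulmxA mulVmx ?mul1mx.
rewrite /Eop invG GopE qB_subV (bmw_elt_skein hw (rB_sqr R) h3).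
have r0 : r != 0 by rewrite rB_eq_i neq0Ci.
rewrite -[RHS]/(3^-1 *: (pottsA w *m pottsB w)).
move: (3^-1 *: _) => E.
by rewrite scalerA (mulVf r0) scale1r opprB addrC subrK.
Qed.

End YangBaxterOperator.

Theorem proposition12p6 (R : realType) :
  exists rho : forall n : nat,
      {rmorphism bmw (rB R) (qB R) n -> 'M[R[i]]_(3 ^ n)},
    [/\ forall n, scalable (rho n),
        forall n (i : 'I_n.-1),
          rho n (bmw_g (rB R) (qB R) i) = local_copy (Gop R) i /\
          rho n (bmw_e (rB R) (qB R) i) = local_copy (Eop R) i,
        forall n (i : 'I_n.-1),
          local_copy (Eop R) i *m local_copy (Eop R) i
            = 3 *: local_copy (Eop R) i &
        bmw_markov_trace 3 (fun n (a : bmw (rB R) (qB R) n) =>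
                              3 ^- n * \tr (rho n a))].
Proof.
have h3 : 3 != 0 :> R[i] by rewrite pnatr_eq0.
have hw := omega3_quadratic R.
have rel := @bmw_image_rel _ _ h3 hw _ (rB_sqr R) _ (qB_subV R).
pose rho n := pres_lift_rmorphism (rel n); exists rho.
have rho_pi n u : rho n (pres_pi (@bmw_rel _ (rB R) (qB R) n) u) =
    term_eval (@bmw_image _ (omega3 R) (rB R) n) u.
  exact: (pres_lift_pi (rel n)).
have rho_scale n : scalable (rho n) by exact: (pres_lift_scalable (rel n)).
have rho_incl n (a : bmw (rB R) (qB R) n) :
    rho n.+1 (bmw_incl a) = add_strand (rho n a).
  by rewrite -(pres_piK a) bmw_incl_pi !rho_pi term_eval_widen.
split=> //.
- by move=> n i; rewrite GopE EopE !rho_pi.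
- by move=> n i; rewrite EopE -local_copyM bmwE_idem // local_copyZ.
split=> [n c a b|n|n a b|m a].
- by rewrite rmorphD rho_scale /= mxtraceD mxtraceZ mulrDr mulrCA.
- by rewrite rmorph1 mxtrace1 natrX mulVf // expf_neq0.
- by rewrite !rmorphM /= mxtrace_mulC.
(* The normalization of the added strand yields the 1/3 of the Markov property; the partial trace
   yields r or r^-1. *)
have scale3 (x y : R[i]) : 3 ^- m.+2 * (x * y) = x / 3 * (3 ^- m.+1 * y).
  by rewrite exprS invfM; ring.
rewrite !rmorphM rho_incl !rho_pi; split.
- by rewrite last_tr_bmw_elt.
- by rewrite last_tr_bmw_elt.
- by rewrite last_tr_bmwE // exprS invfM mulrA.
Qed.
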